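(* Let $R$ be a DT ring with $2\in\Delta(R)$, and let $G$ be a locally finite $2$-group. Then the group ring $RG$ is a DT ring.
   Context: All rings are associative with identity; $U(R)$ is the group of units. $\Delta(R)=\{x\in R: x+u\in U(R)\text{ for all }u\in U(R)\}$. $\mathrm{Tr}(R)=\{x\in R: x^3=x\}$. A ring $R$ is a DT ring if every $r\in R$ can be written $r=e+d$ with $e\in\mathrm{Tr}(R)$ and $d\in\Delta(R)$. A group is locally finite if every finitely generated subgroup is finite. $RG$ denotes the group ring. *)

(* Defs.v *)
From HB Require Import structures.
From mathcomp Require Import all_boot all_order all_algebra.
From mathcomp Require Import finmap.
Set Implicit Arguments. Unset Strict Implicit. Unset Printing Implicit Defensive.
Import Order.TTheory GRing.Theory Num.Theory.
Local Open Scope fset_scope.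

(* Units, Delta, tripotents and DT rings are stated for any carrier with an
   addition, a multiplication and a unit; they are specialised below both to
   MathComp rings and to the group ring RG. *)
Section RingNotions.
Variables (T : Type) (add mul : T -> T -> T) (one : T).

Definition is_unit_op (u : T) : Prop :=
  exists v, mul u v = one /\ mul v u = one.

Definition in_Delta_op (x : T) : Prop :=
  forall u, is_unit_op u -> is_unit_op (add x u).

Definition in_Tr_op (x : T) : Prop := mul x (mul x x) = x.

Definition DT_op : Prop :=
  forall r : T, exists e d, in_Tr_op e /\ in_Delta_op d /\ r = add e d.
End RingNotions.

Definition in_Delta (R : pzRingType) (x : R) :=
  in_Delta_op (@GRing.add R) (@GRing.mul R) (1%R : R) x.
Definition DT_ring (R : pzRingType) :=
  DT_op (@GRing.add R) (@GRing.mul R) (1%R : R).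

Section GroupNotions.
Variable G : groupType.
Local Open Scope group_scope.

Definition in_gen (s : seq G) (x : G) : Prop :=
  exists w : seq (bool * G),
    all (fun p => p.2 \in s) w /\
    x = foldr (fun p acc => (if p.1 then p.2 else p.2^-1) * acc) 1 w.

Definition locally_finite : Prop :=
  forall s : seq G, exists t : seq G, forall x, in_gen s x -> x \in t.

Definition two_group : Prop := forall x : G, exists n : nat, x ^+ (2 ^ n) = 1.
End GroupNotions.

Definition group_ring (R : pzRingType) (G : groupType) :=
  {fsfun G -> R with 0%R}.

Section GroupRing.
Variables (R : pzRingType) (G : groupType).
Local Notation RG := (group_ring R G).

Definition gr_add (a b : RG) : RG :=
  [fsfun g in finsupp a `|` finsupp b => (a g + b g)%R | 0%R].

Definition gr_mul (a b : RG) : RG :=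
  [fsfun g in [fset (h * k)%g | h in finsupp a, k in finsupp b] =>
     (\sum_(h <- finsupp a) a h * b ((h^-1) * g)%g)%R | 0%R].

Definition gr_one : RG := [fsfun g in [fset (1%g : G)] => 1%R | 0%R].
End GroupRing.

Definition DT_group_ring (R : pzRingType) (G : groupType) : Prop :=
  DT_op (@gr_add R G) (@gr_mul R G) (@gr_one R G).

(* Main.v *)
(* Doubles are quasi-regular: writing r = e + d gives 1 + 2r = (1 + 2e) + 2d,
   where 2d lies in Delta(R) and 1 + 2e is invertible because 3 is. Hence an
   element of RG is invertible as soon as its augmentation is, and this gives
   the theorem: if eps(x) = e + d, then x = e + (x - e), and adding a unit to
   x - e keeps the augmentation invertible.

   To lift units along the augmentation, note that x lies in RH for a finite
   2-subgroup H, and climb a chain of subgroups of index 2. For K < H of index 2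
   and t in H outside K, write x = a + bt with a, b in RK. Multiplying x by the
   inverse of eps(a) + eps(b) t in R[C_2], which exists because 1 + 2R consists
   of units, one may assume eps(a) = 1 and eps(b) = 0. Then a is invertible in
   RK, x = a (1 + jt) with eps(j) = 0, and (1 + jt)(1 - jt) = 1 - j (t j t^-1) t^2
   is an element of RK of augmentation 1, hence invertible in RK. *)
Require Import Defs.
From HB Require Import structures.
From mathcomp Require Import all_boot all_order all_algebra all_fingroup all_solvable.
From mathcomp Require Import finmap boolp.
Set Implicit Arguments. Unset Strict Implicit. Unset Printing Implicit Defensive.
Import GRing.Theory.
Local Open Scope ring_scope.

Definition invertible (R : pzRingType) (x : R) := is_unit_op *%R (1 : R) x.

(** * Units of R: quasi-regular doubles and inverses in R[C_2] *)

Section Invertible.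
Variable R : pzRingType.
Implicit Types u v w x : R.

Lemma invertibleM u v : invertible u -> invertible v -> invertible (u * v).
Proof.
move=> [u' [uu' u'u]] [v' [vv' v'v]]; exists (v' * u'); split.
  by rewrite mulrA -(mulrA u) vv' mulr1.
by rewrite mulrA -(mulrA v') u'u mulr1.
Qed.

Lemma left_right_inverse x y z : z * x = 1 -> x * y = 1 -> z = y.
Proof. by move=> zx xy; rewrite -[z]mulr1 -xy mulrA zx mul1r. Qed.

Lemma DeltaD x y : in_Delta x -> in_Delta y -> in_Delta (x + y).
Proof. by move=> Dx Dy u Uu; rewrite -addrA; apply/Dx/Dy. Qed.

(** The right inverse [y * p] and the left inverse [q * z] of [x] must coincide. *)
Lemma invertible_two_sided x y z :
  invertible (x * y) -> invertible (z * x) -> invertible x.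
Proof.
move=> [p [xyp _]] [q [_ qzx]]; exists (y * p); split; first by rewrite mulrA.
suff <- : q * z = y * p by rewrite -mulrA.
by apply: (@left_right_inverse x); rewrite ?mulrA // -mulrA.
Qed.

(** Invertibility is traced back to 3 by [(1 + 2e)(1 + 2e - 2e^2) = 1 + 2e^2] and
    [(1 + 2e^2)(3 - 2e^2) = 3], which also hold with the factors swapped. Below, [p] is [2e^2] and
    [q] is [2e]. *)
Lemma invertible_double_tripotent e : invertible (1 + 2%:R : R) ->
  @in_Tr_op R *%R e -> invertible (1 + e *+ 2).
Proof.
rewrite /in_Tr_op => U3 e3; pose p := (e * e) *+ 2; pose q := e *+ 2.
have pp : p * p = p + p.
  by rewrite mulrnAr mulrnAl -mulrA e3 -mulr2n.
have qq : q * q = p + p by rewrite mulrnAr mulrnAl -mulr2n.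
have qp : q * p = q + q by rewrite mulrnAr mulrnAl e3 -mulr2n.
have pq : p * q = q + q by rewrite mulrnAr mulrnAl -mulrA e3 -mulr2n.
rewrite -/q; clearbody p q; have Up : invertible (1 + p).
  have E3 : p * (1 + 2%:R) = p + p * p.
    by rewrite mulrDr mulr1 mulr_natr mulr2n pp.
  have E3' : (1 + 2%:R) * p = p + p * p.
    by rewrite mulrDl mul1r mulr_natl mulr2n pp.
  apply: (@invertible_two_sided _ (1 + 2%:R - p) (1 + 2%:R - p)).
    by rewrite mulrBr mulrDl mul1r E3 mulrDl mul1r addrK.
  by rewrite mulrBl mulrDr mulr1 E3' mulrDr mulr1 addrK.
have E : 1 + q + (q + (p + p)) = 1 + p + (p + (q + q)).
  by rewrite [LHS](AC (2*(1*2))%AC ((1*4)*(5*(2*3)))%AC).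
apply: (@invertible_two_sided _ (1 + q - p) (1 + q - p)).
  by rewrite mulrBr mulrDl mul1r mulrDr mulr1 qq mulrDl mul1r qp E addrK.
by rewrite mulrBl mulrDr mulr1 mulrDl mul1r qq mulrDr mulr1 pq E addrK.
Qed.

Lemma double_quasi_regular : DT_ring R -> in_Delta (2%:R : R) ->
  forall r : R, invertible (1 + r *+ 2).
Proof.
move=> DT D2 r; have [e [d [Te [Dd ->]]]] := DT r.
have D2d : in_Delta (d *+ 2) by rewrite mulr2n; apply: DeltaD.
rewrite mulrnDl addrA addrC; apply/D2d/invertible_double_tripotent => //.
(* 3 is the sum of 2, which lies in Delta(R), and the unit 1. *)
by rewrite addrC; apply: D2; exists 1; rewrite mulr1.
Qed.

(* [ga + de t] is the inverse of [al + be t] in the group ring of [{1, t}]. *)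
Lemma cyclic2_inverse (al be : R) :
  (forall r : R, invertible (1 + r *+ 2)) -> invertible (al + be) ->
  exists ga de, [/\ al * ga + be * de = 1, al * de + be * ga = 0,
                    ga * al + de * be = 1 & ga * be + de * al = 0].
Proof.
move=> U2 Uu; have [w [uw wu]] := Uu.
have [z [vz zv]] : invertible (al - be).
  suff -> : al - be = (al + be) * (1 + (- (w * be)) *+ 2) by apply: invertibleM.
  rewrite mulrDr mulr1 mulrnAr mulrN mulrA uw mul1r mulr2n addrA.
  by rewrite addrK.
have E : z * be * w = w * be * z.
  (* Both sides equal [be - 2 be w be]; multiplying by [z] on each side then gives [E]. *)
  have : be * w * (al - be) = (al - be) * w * be.
    have -> : al - be = (al + be) - be *+ 2 by rewrite mulr2n opprD addrA addrK.
    rewrite mulrBr -mulrA wu mulr1 !mulrBl uw mul1r !mulrnAr.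
    by rewrite !mulrnAl.
  move/(congr1 (fun m => z * m * z)); rewrite !mulrA zv mul1r.
  by rewrite -!mulrA vz mulr1 !mulrA.
(* Setting [t = 1] and [t = -1] forces [ga + de = w] and [ga - de = z]. Since [w - z = - 2 z be w],
   halving suggests these formulas, which involve no division by 2. *)
exists (w + z * be * w), (- (z * be * w)).
have vE : (al - be) * (z * be * w) = be * w by rewrite !mulrA vz mul1r.
have Ev : (z * be * w) * (al - be) = w * be.
  by rewrite E -!mulrA zv mulr1.
move: vE Ev uw wu; set d := z * be * w.
rewrite !(mulrDl, mulrDr, mulNr, mulrN) => vE Ev uw wu; split.
- by rewrite -addrA vE.
- by rewrite [be * w + _]addrC addrA [- _ + _]addrC -opprB vE addNr.
- by rewrite -addrA Ev.
- by rewrite -addrA -opprB Ev subrr.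
Qed.
End Invertible.

(** * Lifting units from a subring S to S + St, the model of an index 2 step *)

Section Index2Extension.
Variables (R A : pzRingType) (eps : {rmorphism A -> R}) (iota : {rmorphism R -> A}).
Hypothesis iotaK : cancel iota eps.
Hypothesis invertible_double : forall r : R, invertible (1 + r *+ 2).

(** The inverse is required to stay in [S], so that it can be used as a coefficient at the next step
    of the chain. *)
Definition reflects_units (S : A -> Prop) :=
  forall x, S x -> invertible (eps x) -> exists y, [/\ S y, x * y = 1 & y * x = 1].

Variables (S : A -> Prop) (t t' : A).
Hypotheses (SB : forall x y, S x -> S y -> S (x - y)).
Hypotheses (SM : forall x y, S x -> S y -> S (x * y)).
Hypothesis S_iota : forall r, S (iota r).
Hypotheses (tt' : t * t' = 1) (t't : t' * t = 1) (eps_t : eps t = 1).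
Hypothesis S_conj : forall x, S x -> S (t * x * t').
Hypothesis S_t2 : S (t * t).
Hypothesis unitS : reflects_units S.

(** For [S] = RK and [t] a representative of the nontrivial coset, this is RH. *)
Definition adjoined (x : A) := exists a b, [/\ S a, S b & x = a + b * t].

Let S1 : S 1. Proof. by rewrite -(rmorph1 iota). Qed.
Let SN x : S x -> S (- x).
Proof. by move=> Sx; rewrite -[- x]add0r -(rmorph0 iota); apply: SB. Qed.
Let SD x y : S x -> S y -> S (x + y).
Proof. by move=> Sx Sy; rewrite -[y]opprK; apply/SB/SN. Qed.
Let tM x : t * x = t * x * t' * t. Proof. by rewrite -mulrA t't mulr1. Qed.

Let eps_t' : eps t' = 1.
Proof. by rewrite -[LHS]mul1r -eps_t -rmorphM tt' rmorph1. Qed.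

(** Coefficients move past [t] by conjugation, [t c = (t c t') t], and [t * t] is absorbed into the
    coefficients. *)
Let mul_adj a b c d :
  (a + b * t) * (c + d * t) =
  (a * c + b * (t * d * t') * (t * t)) + (a * d + b * (t * c * t')) * t.
Proof.
have E m : b * t * m = b * (t * m * t') * t by rewrite -[RHS]mulrA -tM mulrA.
rewrite mulrDl !mulrDr mulrDl E [b * t * _]mulrA E !mulrA.
by rewrite [LHS](AC (2*2)%AC ((1*4)*(2*3))%AC).
Qed.

Let S_mul0 a b c d : S a -> S b -> S c -> S d -> S (a * c + b * (t * d * t') * (t * t)).
Proof. by move=> *; apply: SD; apply: SM => //; apply: SM => //; apply: S_conj. Qed.
Let S_mul1 a b c d : S a -> S b -> S c -> S d -> S (a * d + b * (t * c * t')).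
Proof. by move=> *; apply: SD; apply: SM => //; apply: S_conj. Qed.

Let adjoinedM x y : adjoined x -> adjoined y -> adjoined (x * y).
Proof.
move=> [a [b [Sa Sb ->]]] [c [d [Sc Sd ->]]]; rewrite mul_adj.
exists (a * c + b * (t * d * t') * (t * t)), (a * d + b * (t * c * t')).
by split=> //; [apply: S_mul0 | apply: S_mul1].
Qed.

Let adjoinedS x : S x -> adjoined x.
Proof.
move=> Sx; exists x, 0; split; rewrite ?mul0r ?addr0 //.
by rewrite -(rmorph0 iota).
Qed.

Let unit_split a b : S a -> S b -> eps a = 1 -> eps b = 0 ->
  exists y, [/\ adjoined y, (a + b * t) * y = 1 & y * (a + b * t) = 1].
Proof.
move=> Sa Sb ea eb.
have [a' [Sa' aa' a'a]] : exists y, [/\ S y, a * y = 1 & y * a = 1].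
  by apply: unitS => //; rewrite ea; exists 1; rewrite mulr1.
pose j := a' * b; have Sj : S j by apply: SM.
have ej : eps j = 0 by rewrite rmorphM eb mulr0.
have aj : a * j = b by rewrite mulrA aa' mul1r.
clearbody j.
pose s := j * (t * j * t') * (t * t).
have Ss : S s by apply: SM S_t2; apply: SM => //; apply: S_conj.
have [c [Sc c1 c2]] : exists y, [/\ S y, (1 - s) * y = 1 & y * (1 - s) = 1].
  apply: unitS; first exact: SB.
  by rewrite rmorphB rmorph1 /s !rmorphM ej !mul0r subr0; exists 1; rewrite mulr1.
have jtjt : j * t * (j * t) = s.
  by rewrite /s -!mulrA [t' * _]mulrA t't mul1r.
have E1 : (1 + j * t) * (1 - j * t) = 1 - s.
  by rewrite mulrBr mulr1 mulrDl mul1r jtjt opprD addrA addrK.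
have E2 : (1 - j * t) * (1 + j * t) = 1 - s.
  by rewrite mulrBl mul1r mulrDr mulr1 jtjt opprD addrA addrK.
have xE : a + b * t = a * (1 + j * t).
  by rewrite mulrDr mulr1 mulrA aj.
(* This inverts [a (1 + j t)]: the factor [c] is the inverse of [(1 + j t)(1 - j t) = 1 - s]. *)
exists ((1 - j * t) * c * a'); split.
- apply: adjoinedM; last exact: adjoinedS.
  apply: adjoinedM; last exact: adjoinedS.
  by exists 1, (- j); rewrite mulNr; split=> //; apply: SN.
- by rewrite xE -!mulrA [_ * (_ * (c * _))]mulrA E1 [_ * (c * _)]mulrA c1 mul1r.
(* One side is a left inverse of [1 + j t] and the other a right inverse. *)
- have <- : c * (1 - j * t) = (1 - j * t) * c.
    apply: (@left_right_inverse _ (1 + j * t)); last by rewrite mulrA E1.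
    by rewrite -mulrA E2.
  by rewrite xE -!mulrA [a' * _]mulrA a'a mul1r E2.
Qed.

(** The lift [y] of the inverse in R[C_2] makes both [x * y] and [y * x] fall under [unit_split];
    this gives a right and a left inverse of [x], which agree. *)
Lemma reflects_units_adjoined : reflects_units adjoined.
Proof.
move=> _ [a [b [Sa Sb ->]]]; rewrite rmorphD rmorphM eps_t mulr1 => Uab.
have [ga [de [e1 e2 e3 e4]]] := cyclic2_inverse invertible_double Uab.
set x := a + b * t; pose y := iota ga + iota de * t.
have Ty : adjoined y by exists (iota ga), (iota de).
have [p [Tp xyp _]] : exists p, [/\ adjoined p, x * y * p = 1 & p * (x * y) = 1].
  rewrite mul_adj; apply: unit_split.
  - exact: S_mul0.
  - exact: S_mul1.
  - by rewrite rmorphD !(rmorphM eps) eps_t eps_t' !iotaK !(mulr1, mul1r).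
  - by rewrite rmorphD !(rmorphM eps) eps_t eps_t' !iotaK !(mulr1, mul1r).
have [q [Tq _ qyx]] : exists p, [/\ adjoined p, y * x * p = 1 & p * (y * x) = 1].
  rewrite mul_adj; apply: unit_split.
  - exact: S_mul0.
  - exact: S_mul1.
  - by rewrite rmorphD !(rmorphM eps) eps_t eps_t' !iotaK !(mulr1, mul1r).
  - by rewrite rmorphD !(rmorphM eps) eps_t eps_t' !iotaK !(mulr1, mul1r).
have E : q * y = y * p.
  by apply: (@left_right_inverse _ x); rewrite ?mulrA // -mulrA.
exists (y * p); split; [exact: adjoinedM | by rewrite mulrA | by rewrite -E -mulrA].
Qed.
End Index2Extension.

(** * Ring structure on RG, scalars and the augmentation morphism *)

Section GroupRingStructure.
Variables (R : pzRingType) (G : groupType).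
Local Notation RG := (group_ring R G).
Implicit Types (a b c : RG) (g h k : G) (r : R) (A B : {fset G}).

HB.instance Definition _ := Equality.copy RG {fsfun G -> R with 0}.
HB.instance Definition _ := [Choice of RG by <:].

Lemma gr_addE a b g : gr_add a b g = a g + b g.
Proof.
rewrite fsfun_fun in_fsetU; case: ifP => //.
by move/norP => [] /fsfun_dflt-> /fsfun_dflt->; rewrite addr0.
Qed.

Definition gr_zero : RG := [fsfun].
Definition gr_opp a : RG := [fsfun g in finsupp a => - a g | 0].

Lemma gr_oppE a g : gr_opp a g = - a g.
Proof. by rewrite fsfun_fun; case: finsuppP => //; rewrite oppr0. Qed.

Lemma gr_addA : associative (@gr_add R G).
Proof. by move=> a b c; apply/fsfunP => g; rewrite !gr_addE addrA. Qed.
Lemma gr_addC : commutative (@gr_add R G).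
Proof. by move=> a b; apply/fsfunP => g; rewrite !gr_addE addrC. Qed.
Lemma gr_add0 : left_id gr_zero (@gr_add R G).
Proof. by move=> a; apply/fsfunP => g; rewrite gr_addE fsfun0E add0r. Qed.
Lemma gr_addN : left_inverse gr_zero gr_opp (@gr_add R G).
Proof. by move=> a; apply/fsfunP => g; rewrite gr_addE gr_oppE fsfun0E addNr. Qed.

HB.instance Definition _ := GRing.isZmodule.Build RG gr_addA gr_addC gr_add0 gr_addN.

Lemma sum_finsupp a A (F : G -> R) : (finsupp a `<=` A)%fset ->
  (forall g, a g = 0 -> F g = 0) -> \sum_(g <- finsupp a) F g = \sum_(g <- A) F g.
Proof.
move=> sub F0; apply: big_fset_incl => // g _ /fsfun_dflt; exact: F0.
Qed.

Lemma gr_mulE a b A g : (finsupp a `<=` A)%fset ->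
  gr_mul a b g = \sum_(h <- A) a h * b (h^-1 * g)%g.
Proof.
move=> sub; rewrite fsfun_fun -(sum_finsupp sub); last by move=> h ->; rewrite mul0r.
(* Outside the product of the two supports every term of the convolution vanishes, so the default
   value 0 is the right one. *)
case: ifP => // /negP gN; rewrite big_seq big1 // => h ha.
case: (finsuppP b (h^-1 * g)%g) => [_|hb]; first by rewrite mulr0.
by case: gN; apply/imfset2P; exists h => //; exists (h^-1 * g)%g => //; rewrite mulVKg.
Qed.

(** Substituting [m = h * k] turns the right side into a sum over the translate of the support of
    [b] by [h]; the other [m] contribute 0. It serves for associativity, and with [F = 1] for
    multiplicativity of the augmentation. *)
Lemma sum_translate b A h (F : G -> R) : h \in A ->
  \sum_(m <- [fset (k * l)%g | k in A, l in finsupp b]%fset) b (h^-1 * m)%g * F m =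
  \sum_(k <- finsupp b) b k * F (h * k)%g.
Proof.
move=> hA; pose hB := [fset (h * k)%g | k in finsupp b]%fset.
have -> : \sum_(k <- finsupp b) b k * F (h * k)%g =
          \sum_(m <- hB) b (h^-1 * m)%g * F m.
  rewrite big_imfset /=; last by move=> k l _ _; apply: mulgI.
  by apply: eq_bigr => k _; rewrite mulKg.
apply/esym/big_fset_incl.
  apply/fsubsetP => _ /imfsetP[k kb ->].
  by apply/imfset2P; exists h => //; exists k.
move=> m _ mN; case: (finsuppP b (h^-1 * m)%g) => [_|hb]; first by rewrite mul0r.
by case/negP: mN; apply/imfsetP; exists (h^-1 * m)%g; rewrite //= mulVKg.
Qed.

Lemma finsupp_gr_mul a b :
  (finsupp (gr_mul a b) `<=` [fset (h * k)%g | h in finsupp a, k in finsupp b])%fset.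
Proof. by apply/fsubsetP => g; rewrite mem_finsupp fsfun_fun; case: ifP => // _ /eqP. Qed.

Lemma gr_mulA : associative (@gr_mul R G).
Proof.
move=> a b c; apply/fsfunP => g.
rewrite (gr_mulE _ _ (finsupp_gr_mul a b)) (gr_mulE _ _ (fsubset_refl _)).
under [RHS]eq_bigr => m _ do rewrite (gr_mulE b m (fsubset_refl _)) mulr_suml.
rewrite exchange_big /= big_seq [RHS]big_seq; apply: eq_bigr => h ha.
under [RHS]eq_bigr => m _ do rewrite -mulrA.
rewrite -mulr_sumr (sum_translate _ (fun m => c (m^-1 * g)%g)) //.
rewrite (gr_mulE _ _ (fsubset_refl _)); congr (_ * _).
by apply: eq_bigr => k _; rewrite invgM mulgA.
Qed.

Definition single g r : RG := [fsfun x in [fset g]%fset => r | 0].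

Lemma singleE g r h : single g r h = if h == g then r else 0.
Proof. by rewrite fsfun_fun in_fset1. Qed.

Lemma finsupp_single g r : (finsupp (single g r) `<=` [fset g])%fset.
Proof.
by apply/fsubsetP => x; rewrite mem_finsupp singleE in_fset1; case: (x == g); rewrite // eqxx.
Qed.

Lemma mul_singlel h r b g : gr_mul (single h r) b g = r * b (h^-1 * g)%g.
Proof. by rewrite (gr_mulE _ _ (finsupp_single h r)) big_seq_fset1 singleE eqxx. Qed.

Lemma mul_singler k r a g : gr_mul a (single k r) g = a (g * k^-1)%g * r.
Proof.
(* Only [h = g * k^-1] contributes. It is added to the index set because it may lie outside the
   support of [a]. *)
rewrite (@gr_mulE _ _ ((g * k^-1)%g |` finsupp a)%fset); last exact: fsubsetUr.
rewrite (big_fsetD1 (g * k^-1)%g) ?fset1U1 //= singleE invgM invgK mulgKV eqxx.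
rewrite big_seq big1 ?addr0 // => h; rewrite in_fsetD1 => /andP[hN _].
rewrite singleE; case: eqP => [E|]; rewrite ?mulr0 //.
by case/eqP: hN; rewrite -E invgM mulVKg invgK.
Qed.

Lemma gr_oneE : @gr_one R G = single 1%g 1. Proof. by []. Qed.

Lemma gr_mul1l : left_id (@gr_one R G) (@gr_mul R G).
Proof. by move=> a; apply/fsfunP => g; rewrite gr_oneE mul_singlel mul1r invg1 mul1g. Qed.
Lemma gr_mul1r : right_id (@gr_one R G) (@gr_mul R G).
Proof. by move=> a; apply/fsfunP => g; rewrite gr_oneE mul_singler mulr1 invg1 mulg1. Qed.

Lemma gr_mulDl : left_distributive (@gr_mul R G) (@gr_add R G).
Proof.
move=> a b c; apply/fsfunP => g; rewrite gr_addE.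
set A := (finsupp a `|` finsupp b)%fset.
rewrite !(@gr_mulE _ _ A) ?fsubsetUl ?fsubsetUr ?finsupp_sub //.
by rewrite -big_split; apply: eq_bigr => h _; rewrite gr_addE mulrDl.
Qed.

Lemma gr_mulDr : right_distributive (@gr_mul R G) (@gr_add R G).
Proof.
move=> a b c; apply/fsfunP => g; rewrite gr_addE.
rewrite !(gr_mulE _ _ (fsubset_refl _)) -big_split.
by apply: eq_bigr => h _; rewrite gr_addE mulrDr.
Qed.

HB.instance Definition _ := GRing.Zmodule_isPzRing.Build RG
  gr_mulA gr_mul1l gr_mul1r gr_mulDl gr_mulDr.

Lemma singleM g h r s : (single g r * single h s = single (g * h)%g (r * s) :> RG).
Proof.
apply/fsfunP => k; rewrite mul_singlel !singleE -(inj_eq (mulgI g)) mulVKg.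
by case: eqP => _; rewrite ?mulr0.
Qed.

Definition augmentation a : R := \sum_(g <- finsupp a) a g.
Definition scalar r : RG := single 1%g r.

Lemma augmentation_single g r : augmentation (single g r) = r.
Proof.
by rewrite /augmentation (sum_finsupp (finsupp_single g r)) // big_seq_fset1 singleE eqxx.
Qed.

Lemma augmentation_is_additive : {morph augmentation : a b / a + b}.
Proof.
move=> a b; set A := (finsupp a `|` finsupp b)%fset.
rewrite /augmentation !(@sum_finsupp _ A) ?fsubsetUl ?fsubsetUr ?finsupp_sub //.
by rewrite -big_split; apply: eq_bigr => h _; rewrite gr_addE.
Qed.

Lemma augmentation_is_monoid_morphism : monoid_morphism augmentation.
Proof.
split; first exact: augmentation_single.
move=> a b; rewrite /augmentation (sum_finsupp (finsupp_gr_mul a b)) //.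
under eq_bigr => m _ do rewrite (gr_mulE b m (fsubset_refl _)).
rewrite exchange_big mulr_suml /= big_seq [RHS]big_seq; apply: eq_bigr => h ha.
rewrite -mulr_sumr; congr (_ * _).
have /= := sum_translate b (fun=> 1) ha.
by under eq_bigr do rewrite mulr1; under [RHS]eq_bigr do rewrite mulr1.
Qed.

Lemma augmentation_zmod_morphism : zmod_morphism augmentation.
Proof.
move=> a b; apply/eqP; rewrite -subr_eq opprK -augmentation_is_additive.
by rewrite subrK.
Qed.

Lemma scalar_zmod_morphism : zmod_morphism scalar.
Proof.
move=> r s; apply/fsfunP => g; rewrite gr_addE gr_oppE !singleE.
by case: eqP => _; rewrite ?subr0.
Qed.

Lemma scalar_monoid_morphism : monoid_morphism scalar.
Proof.
by split=> // r s; rewrite singleM mulg1.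
Qed.

HB.instance Definition _ := GRing.isZmodMorphism.Build RG R augmentation
  augmentation_zmod_morphism.
HB.instance Definition _ := GRing.isMonoidMorphism.Build RG R augmentation
  augmentation_is_monoid_morphism.
HB.instance Definition _ := GRing.isZmodMorphism.Build R RG scalar scalar_zmod_morphism.
HB.instance Definition _ := GRing.isMonoidMorphism.Build R RG scalar
  scalar_monoid_morphism.

Lemma scalarK : cancel scalar augmentation.
Proof. exact: augmentation_single. Qed.
End GroupRingStructure.

(** * The subrings RK inside RG, and the index 2 step for them *)

Section Support.
Variables (R : pzRingType) (G : groupType).
Local Notation RG := (group_ring R G).
Hypothesis invertible_double : forall r : R, invertible (1 + r *+ 2).
Local Open Scope group_scope.

(** This stands for RK as a subset of RG, so that one ring and one augmentation serve every
    subgroup. *)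
Definition supported (K : pred G) (x : RG) := forall g, x g != 0%R -> K g.

Lemma supportedB K x y : supported K x -> supported K y -> supported K (x - y)%R.
Proof.
move=> Kx Ky g; rewrite gr_addE gr_oppE.
by have [->|/Kx //] := eqVneq (x g) 0%R; rewrite sub0r oppr_eq0 => /Ky.
Qed.

Lemma supportedM (K : pred G) x y : (forall g h, K g -> K h -> K (g * h)) ->
  supported K x -> supported K y -> supported K (x * y)%R.
Proof.
move=> KM Kx Ky g; apply: contraNT => gN.
rewrite (gr_mulE _ _ (fsubset_refl _)) big_seq big1 // => h.
rewrite mem_finsupp => /Kx Kh.
have [->|/Ky Khg] := eqVneq (y (h^-1 * g)) 0%R; first by rewrite mulr0.
by move: (KM _ _ Kh Khg); rewrite mulVKg (negPf gN).
Qed.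

Lemma supported_single (K : pred G) g r : K g -> supported K (single g r).
Proof. by move=> Kg h; rewrite singleE; case: (h =P g) => [->|] //; rewrite eqxx. Qed.

Lemma supported1 x : supported (pred1 1) x -> x = scalar G (augmentation x).
Proof.
move=> sx; apply/fsfunP => g; rewrite singleE.
have sub : (finsupp x `<=` [fset 1])%fset.
  by apply/fsubsetP => h; rewrite mem_finsupp in_fset1 => /sx.
rewrite /augmentation (sum_finsupp sub) // big_seq_fset1.
case: eqP => [-> //|gN1]; apply/eqP/negPn/negP => /sx /eqP; exact: gN1.
Qed.

Lemma reflects_units_supported1 :
  reflects_units (@augmentation R G) (supported (pred1 1)).
Proof.
move=> x /supported1 xE [r [xr rx]]; exists (scalar G r); split.
- by apply: supported_single => /=.
- by rewrite xE -rmorphM xr rmorph1.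
- by rewrite xE -rmorphM rx rmorph1.
Qed.

(** The hypotheses make [H] the union of [K] and [Kt], so RH = RK + (RK)t and
    [reflects_units_adjoined] applies. *)
Lemma reflects_units_index2 (K H : pred G) (t : G) :
  K 1 -> (forall g h, K g -> K h -> K (g * h)) ->
  (forall g, K g -> K (t * g * t^-1)) ->
  K (t * t) -> (forall g h, H g -> H h -> H (g * h)) ->
  subpred K H -> H t -> (forall g, H g -> K g \/ K (g * t^-1)) ->
  reflects_units (@augmentation R G) (supported K) ->
  reflects_units (@augmentation R G) (supported H).
Proof.
move=> K1 KM KJ Kt2 HM sKH Ht HK unitK x Hx Ux.
have sub y : supported K y -> supported H y by move=> Ky g /Ky /sKH.
have tt' (s s' : G) : s * s' = 1 -> (single s 1 * single s' 1 = 1 :> RG)%R.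
  by move=> E; rewrite singleM E mulr1.
have sMt (y : RG) (s g : G) : (y * single s 1)%R g = y (g * s^-1).
  by rewrite mul_singler mulr1.
have adjE y : adjoined (supported K) (single t 1) y -> supported H y.
  move=> [a [b [Ka Kb ->]]].
  rewrite -[(_ * single t 1)%R]opprK -[(- (_ * _))%R]sub0r; apply: supportedB.
    exact: sub.
  apply: supportedB; first by move=> g; rewrite fsfun0E eqxx.
  by apply: supportedM => //; [apply: sub | apply: supported_single].
suff [y [Ty xy yx]] : exists y,
    [/\ adjoined (supported K) (single t 1) y, x * y = 1 & y * x = 1]%R.
  by exists y; split=> //; apply: adjE.
apply: (@reflects_units_adjoined R RG (@augmentation R G) (@scalar R G) (@scalarK R G)
  invertible_double (supported K) (single t 1) (single t^-1 1)) => //.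
- exact: supportedB.
- by move=> y z; apply: supportedM.
- by move=> r; apply: supported_single.
- by apply: tt'; rewrite mulgV.
- by apply: tt'; rewrite mulVg.
- exact: augmentation_single.
- move=> y Ky g; rewrite sMt invgK mul_singlel mul1r => /Ky /KJ.
  by rewrite !mulgA mulgV mul1g mulgK.
- by rewrite singleM mulr1; apply: supported_single.
(* [a] is the part of [x] on [K]. The rest lives on [Kt], and right translation by [t^-1] brings it
   into RK. *)
pose a : RG := [fsfun g in finsupp x => if K g then x g else 0%R | 0%R].
have aE g : a g = if K g then x g else 0%R.
  by rewrite fsfun_fun; case: finsuppP => //; case: ifP.
exists a, ((x - a) * single t^-1 1)%R; split.
- by move=> g; rewrite aE; case: ifP => //; rewrite eqxx.
- move=> g; rewrite sMt invgK gr_addE gr_oppE aE.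
  case: ifP => [_|KN]; first by rewrite subrr eqxx.
  rewrite subr0 => /Hx /HK [|]; first by rewrite KN.
  by rewrite mulgK.
- by rewrite -mulrA tt' ?mulVg // mulr1 addrC subrK.
Qed.
End Support.

(** * Lifting units in RL for a finite 2-subgroup L *)

Section FiniteSubgroup.
Variables (R : pzRingType) (G : groupType) (L : {fset G}).
Hypothesis invertible_double : forall r : R, invertible (1 + r *+ 2).
Hypothesis L_group : group_closed (fun g : G => g \in L).
Hypothesis G2 : two_group G.
Local Open Scope group_scope.

(** As a type, [L] receives a finite group structure, which opens up the theory of finite
    p-groups. *)
Let H := fset_sub_type L.
HB.instance Definition _ := SubFinite.on H.
HB.instance Definition _ := SubChoice_isSubGroup.Build G (fun g => g \in L) H L_group.

(** By Cauchy, a prime dividing the order of [K] is the order of an element, hence divides a power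
    of 2. *)
Let pgroupH (K : {group H}) : 2.-group K.
Proof.
apply/pgroupP => q q_pr /(Cauchy q_pr)[x _ xq].
have [n xn] := G2 (val x); have : (#[x]%g %| 2 ^ n)%N.
  by rewrite order_dvdn; apply/eqP/val_inj; rewrite gmulfXn xn gmulf1.
by rewrite xq Euclid_dvdX // => /andP[]; rewrite dvdn_prime2.
Qed.

Lemma reflects_units_subgroup (K : {group H}) :
  reflects_units (@augmentation R G) (supported [in image val K]).
Proof.
have [n] := ubnP #|K|; elim: n K => // n IHn K /ltnSE-leKn.
case: (maximal_exists (sub1G K)) => [K1|[M maxM _]].
  move=> x Kx Ux; have [|y [y1 xy yx]] := reflects_units_supported1 _ Ux.
    by move=> g /Kx /imageP[h]; rewrite -K1 => /set1P-> ->; rewrite gmulf1 /=.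
  exists y; split=> // g /y1 /eqP->.
  by apply/imageP; exists 1; rewrite ?gmulf1.
have [/andP[sMK /subsetPn[t Kt MNt]] _] := maxgroupP maxM.
(* A maximal subgroup of a finite 2-group is normal of index 2, which supplies the chain for the
   induction on the order of [K]. *)
have nMK := p_maximal_normal (pgroupH K) maxM.
have iM : #|K : M|%g = 2 := p_maximal_index (pgroupH K) maxM.
(* By counting: the two cosets are disjoint, lie in [K], and together have its cardinality. *)
have KE : K :=: M :|: M :* t.
  apply/esym/eqP; rewrite eqEcard subUset sMK /= -{1}(mulGid K) mulgSS ?sub1set //=.
  have MMt0 : M :&: M :* t = set0.
    apply/setP => h; rewrite !inE mem_rcoset; apply/negP => /andP[Mh].
    by rewrite groupMl // groupV (negPf MNt).
  by rewrite cardsU MMt0 cards0 subn0 card_rcoset -(Lagrange sMK) iM muln2 addnn.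
(* Otherwise [t * t] would lie in the coset [Mt], forcing [t] into [M]. *)
have Mt2 : t * t \in M.
  have : t * t \in K by rewrite groupM.
  rewrite KE in_setU => /orP[//|]; rewrite mem_rcoset mulgK => Mt.
  by case/negP: MNt.
have ltMn : (#|M| < n)%N.
  by apply: leq_trans (proper_card _) leKn; apply/properP; split=> //; exists t.
apply: (@reflects_units_index2 R G invertible_double [in image val M] _ (val t)) (IHn M ltMn).
- by apply/imageP; exists 1; rewrite ?gmulf1.
- move=> _ _ /imageP[g Mg ->] /imageP[h Mh ->].
  by apply/imageP; exists (g * h); rewrite ?gmulfM ?groupM.
- move=> _ /imageP[g Mg ->]; apply/imageP; exists (t * g * t^-1).
    have -> : t * g * t^-1 = g ^ t^-1 by rewrite conjgE invgK mulgA.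
    by rewrite memJ_norm // groupV (subsetP (normal_norm nMK)).
  by rewrite !gmulfM gmulfV.
- by apply/imageP; exists (t * t); rewrite ?gmulfM.
- move=> _ _ /imageP[g Kg ->] /imageP[h Kh ->].
  by apply/imageP; exists (g * h); rewrite ?gmulfM ?groupM.
- move=> _ /imageP[g Mg ->]; apply/imageP; exists g => //; exact: (subsetP sMK).
- by apply/imageP; exists t.
move=> _ /imageP[g + ->]; rewrite KE => /setUP[Mg|]; first by left; apply/imageP; exists g.
by rewrite mem_rcoset => Mgt; right; apply/imageP; exists (g * t^-1).
Qed.
End FiniteSubgroup.

(** * From finite subgroups to locally finite groups, and the DT property *)

Section DTGroupRing.
Variables (R : pzRingType) (G : groupType).
Hypothesis invertible_double : forall r : R, invertible (1 + r *+ 2).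
Hypotheses (Gfin : locally_finite G) (G2 : two_group G).

Lemma in_genM (s : seq G) g h : in_gen s g -> in_gen s h -> in_gen s (g * h)%g.
Proof.
move=> [v [vs ->]] [w [ws ->]]; exists (v ++ w); rewrite all_cat vs ws; split=> //.
rewrite foldr_cat; elim: v {vs} => [|p v IHv] /=; first by rewrite mul1g.
by rewrite -IHv mulgA.
Qed.

Lemma in_genV (s : seq G) g : in_gen s g -> in_gen s g^-1%g.
Proof.
move=> [w [+ ->]]; elim: w => [|[b h] w IHw] /=.
  by move=> _; exists [::]; rewrite invg1.
move=> /andP[hs /IHw ws]; rewrite invgM; apply: in_genM ws _.
exists [:: (~~ b, h)]; rewrite /= hs mulg1; split=> //.
by case: b; rewrite ?invgK.
Qed.

Lemma in_gen_mem (s : seq G) g : g \in s -> in_gen s g.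
Proof. by move=> gs; exists [:: (true, g)]; rewrite /= gs mulg1. Qed.

Lemma augmentation_reflects_invertible (x : group_ring R G) :
  invertible (augmentation x) -> invertible x.
Proof.
move=> Ux; have [l lP] := Gfin (finsupp x).
(* Local finiteness only provides a list containing the subgroup generated by the support; filtering
   it classically leaves exactly that subgroup. *)
pose L := [fset g in l | `[< in_gen (finsupp x) g >]]%fset.
have LP g : reflect (in_gen (finsupp x) g) (g \in L).
  rewrite !inE /=; apply: (iffP andP) => [[_ /asboolP]//|xg].
  by split; [apply: lP | apply/asboolP].
have L_group : group_closed (fun g => g \in L).
  split; first by apply/LP; exists [::].
  by move=> g h /LP gL /LP hL; apply/LP/in_genM => //; apply: in_genV.
have [|y [_ xy yx]] :=
  @reflects_units_subgroup R G L invertible_double L_group G2 [set: _]%G x _ Ux.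
  move=> g; rewrite -mem_finsupp => /in_gen_mem/LP gL.
  by apply/imageP; exists (Sub g gL).
by exists y.
Qed.
End DTGroupRing.

Theorem theorem3p12 (R : pzRingType) (G : groupType) :
  DT_ring R -> in_Delta (2%:R : R) ->
  locally_finite G -> two_group G ->
  DT_group_ring R G.
Proof.
move=> DT D2 Gfin G2 x.
have U2 := double_quasi_regular DT D2.
have [e [d [Te [Dd xE]]]] := DT (augmentation x).
exists (scalar G e), (x - scalar G e); split; last split; last first.
- by rewrite -[RHS]/(scalar G e + (x - scalar G e)) addrC subrK.
- move=> u [v [uv vu]]; apply: (augmentation_reflects_invertible U2 Gfin G2).
  (* The augmentation of this sum is [d] plus that of [u], and a ring morphism sends the unit [u] to
     a unit. *)
  rewrite -[gr_add _ _]/(x - scalar G e + u) rmorphD rmorphB /= scalarK xE [e + d]addrC addrK.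
  apply: Dd; exists (augmentation v).
  by split; rewrite -rmorphM ?[u * v]uv ?[v * u]vu rmorph1.
- rewrite /in_Tr_op -[LHS]/(scalar G e * (scalar G e * scalar G e)) -!rmorphM.
  exact: congr1 Te.
Qed.
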